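(* The set of all real numbers $\alpha$ such that $\alpha$ is a $d$-number and $\alpha=a+b\sqrt{N}$ for some $N\in\mathbb{Z}_{\geq1}$ and some $a,b\in\frac12\mathbb{Z}_{\geq0}$ is a discrete subset of $\mathbb{R}$.
   Context: An algebraic integer $\alpha$ is a $d$-number if the ideal it generates in the ring of all algebraic integers is invariant under the action of $\mathrm{Gal}(\overline{\mathbb{Q}}/\mathbb{Q})$. *)

(* Defs.v *)
From HB Require Import structures.
From mathcomp Require Import all_boot all_order all_algebra.
From mathcomp Require Import complex.
From mathcomp Require Import all_classical reals topology normedtype.

Set Implicit Arguments.
Unset Strict Implicit.
Unset Printing Implicit Defensive.

Import Order.TTheory GRing.Theory Num.Theory.
Import numFieldNormedType.Exports.
Local Open Scope classical_set_scope.
Local Open Scope ring_scope.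
Local Open Scope complex_scope.

(** The field [Qbar R] of algebraic numbers, as a subfield of the complex
    numbers [R[i]], so that "a real number is an algebraic number" makes sense
    without choosing an embedding of an abstract algebraic closure. *)

Definition is_algebraic (R : realType) : {pred R[i]} :=
  fun z => `[< algebraicOver (ratr : rat -> R[i]) z >].

Fact is_algebraic_divring_closed (R : realType) :
  divring_closed (is_algebraic (R:=R)).
Proof.
split=> [|x y /asboolP Hx /asboolP Hy|x y /asboolP Hx /asboolP Hy];
  apply/asboolP.
- exact: algebraic1.
- exact: algebraic_sub.
- exact: algebraic_div.
Qed.

HB.instance Definition _ (R : realType) :=
  GRing.isDivringClosed.Build R[i] (is_algebraic (R:=R))
    (is_algebraic_divring_closed R).

Record Qbar (R : realType) := MkQbar {
  qbar_val :> R[i];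
  _ : qbar_val \in is_algebraic (R:=R)
}.

HB.instance Definition _ (R : realType) := [isSub for @qbar_val R].
HB.instance Definition _ (R : realType) := [Choice of Qbar R by <:].
HB.instance Definition _ (R : realType) :=
  [SubChoice_isSubIntegralDomain of Qbar R by <:].
HB.instance Definition _ (R : realType) :=
  [SubIntegralDomain_isSubField of Qbar R by <:].

Definition algebraic_integers (R : realType) : set (Qbar R) :=
  [set x | integralOver (intr : int -> Qbar R) x].

Definition principal_ideal (R : realType) (a : Qbar R) : set (Qbar R) :=
  [set a * x | x in @algebraic_integers R].

(** Field automorphisms fix the rational numbers automatically, so
    Gal(Qbar/Q) is the set of all bijective ring morphisms [Qbar -> Qbar]. *)
Definition is_d_number (R : realType) (a : Qbar R) : Prop :=
  algebraic_integers a /\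
  forall sigma : {rmorphism Qbar R -> Qbar R}, bijective sigma ->
    sigma @` principal_ideal a = principal_ideal a.

Definition real_d_number (R : realType) (x : R) : Prop :=
  exists2 a : Qbar R, qbar_val a = x%:C & is_d_number a.

Definition half_natural (R : realType) (y : R) : Prop :=
  exists k : nat, y = k%:R / 2.

Definition discrete_subset (T : topologicalType) (A : set T) : Prop :=
  A `<=` isolated A.

(* Main.v *)
(** The [d]-number condition plays no role: an element below [M] has the form
    [(k + sqrt m) / 2] with [k <= 2 M] and [m <= (2 M)^2] natural numbers
    ([m] absorbs the square of [2 b]), so only finitely many elements lie below
    any bound; finite sets being closed in a T1 space, every point of a locally
    finite set is isolated. *)

Require Import Defs.
From mathcomp Require Import all_boot all_order all_algebra.
From mathcomp Require Import lra.
From mathcomp Require Import all_classical reals topology normedtype.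
Import Order.TTheory GRing.Theory Num.Theory.
Import numFieldNormedType.Exports.
Local Open Scope classical_set_scope.
Local Open Scope ring_scope.

Lemma locally_finite_discrete (T : topologicalType) (A : set T) :
  accessible_space T ->
  (forall x, A x -> exists2 V, nbhs x V & finite_set (V `&` A)) ->
  discrete_subset A.
Proof.
move=> T1 Afin x Ax; split; first exact: mem_set.
have [V xV finVA] := Afin x Ax.
(* [F] holds the finitely many other points of [A] in [V]; cutting this closed set out of [V] leaves
   a neighbourhood of [x] that meets [A] only in [x]. *)
pose F := (V `&` A) `\ x.
have closedF : closed F.
  by apply: (proj1 (@accessible_finite_set_closed T) T1); exact: finite_setD.
exists (V `&` ~` F).
  apply: filterI => //; apply: open_nbhs_nbhs; split.
    by rewrite openC.
  by case=> _; exact.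
apply/seteqP; split=> [y [[Vy nFy] Ay]|_ ->] /=.
  by apply: contrapT => yx; exact: nFy.
split=> //; split; first exact: nbhs_singleton.
by case=> _; exact.
Qed.

Lemma finite_half_quadratic_le (R : realType) (M : R) :
  finite_set [set x : R | x <= M /\ exists (N : nat) (a b : R),
    [/\ half_natural a, half_natural b & x = a + b * Num.sqrt N%:R]].
Proof.
pose f (k m : nat) : R := (k%:R + Num.sqrt m%:R) / 2.
(* The successor makes the truncation a strict upper bound, even for negative [M], as membership in
   [I_K] and [I_L] requires. *)
pose K := (Num.truncn (2 * M)).+1.
pose L := (Num.truncn ((2 * M) ^+ 2)).+1.
apply: (@sub_finite_set _ _ [set f k m | k in `I_K & m in `I_L]); last first.
  exact: finite_image2.
move=> x /= [xM [N [_ [_ [[k ->] [l ->] xE]]]]].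
pose m := (l ^ 2 * N)%N.
have sqrtm : Num.sqrt m%:R = l%:R * Num.sqrt N%:R :> R.
  by rewrite natrM natrX sqrtrM ?sqrtr_sqr ?ger0_norm // exprn_ge0.
have {}xE : x = f k m by rewrite xE /f sqrtm; lra.
(* Both summands of [2 * x] are nonnegative, so each is at most [2 * M]. *)
have k0 : 0 <= k%:R :> R by [].
have s0 : 0 <= Num.sqrt m%:R :> R by exact: sqrtr_ge0.
rewrite /f in xE.
have kM : k%:R <= 2 * M by lra.
have sM : Num.sqrt m%:R <= 2 * M by lra.
exists k; first by rewrite /= -(ltr_nat R) (le_lt_trans kM) // truncnS_gt.
exists m => //=.
rewrite -(ltr_nat R) (le_lt_trans _ (truncnS_gt _)) //.
(* [2 * M] bounds a square root, so it is nonnegative and [sM] may be squared. *)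
by rewrite -(@sqr_sqrtr _ m%:R) // ler_pXn2r // nnegrE; lra.
Qed.

Theorem theorem3p15 (R : realType) :
  discrete_subset
    [set x : R | real_d_number x /\
       exists (N : nat) (a b : R),
         [/\ (1 <= N)%N, half_natural a, half_natural b
           & x = a + b * Num.sqrt N%:R]].
Proof.
apply: locally_finite_discrete => [|x _].
  by apply: hausdorff_accessible; exact: Rhausdorff.
(* The radius is arbitrary: any ball around [x] is bounded above. *)
exists (ball x 1); first exact: nbhsx_ballx.
apply: sub_finite_set (finite_half_quadratic_le R (x + 1)).
move=> y [] /= + [_ [N [a [b [_ ha hb yE]]]]].
rewrite /ball /= ltr_distlC => /andP[_ yx]; split; first exact: ltW.
by exists N, a, b.
Qed.
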